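(* Let $n\ge 2$ and let $c=p^a$ ($p$ an odd prime, $a\ge1$) be a prime power with $c\equiv1\pmod{2n}$ and $c+n=\binom{k}{2}$ for some integer $k\ge 2n$; let $d=1+(c-1)/n$. Let $\mathbb{F}$ be the field of order $c$ with primitive element $\zeta$, $H=N\rtimes\langle\zeta^n\rangle\le\mathrm{AGL}(1,c)$ with $N$ the translation group, $R=\mathbb{Z}_d=\{0,1,\dots,d-1\}$, $K=\mathrm{Sym}(d)$ on $R$, and $G=H\wr K$ acting on $\mathscr{P}=\mathbb{F}\times R$ by $(x,j)^{(h_1,\dots,h_d)\sigma}=(x^{h_j},j^\sigma)$; let $\mathscr{C}=\{C_j:j\in R\}$ with $C_j=\mathbb{F}\times\{j\}$. Let \[B=\{(0,i),(\zeta^i,i):0\le i\le n-1\}\cup\{(0,i):n\le i\le k-n-1\}\] (a $k$-subset of $\mathscr{P}$) and $\mathscr{B}=B^G$. Then $\mathscr{D}=(\mathscr{P},\mathscr{B})$ is a $2$-$(cd,k,\lambda)$ design for some $\lambda$, and $G$ is a block-transitive, point-imprimitive group of automorphisms of $\mathscr{D}$ leaving $\mathscr{C}$ invariant. Moreover: (a) the Delandtsheer--Doyen parameters of $\mathscr{D}$ relative to $G$ and $\mathscr{C}$ are $(m,n)=(1,n)$; (b) $\mathrm{Rank}(H)=\mathrm{PairRank}(H)+1=n+1$ and $\mathrm{Rank}(K)=\mathrm{PairRank}(K)+1=2$.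
   Context: A $2$-$(v,k,\lambda)$ design has $v$ points, blocks which are $k$-subsets, every pair of distinct points in exactly $\lambda$ blocks. For a block-transitive group preserving a partition into $d$ classes of size $c$, inner pairs are unordered pairs of distinct points in the same class and outer pairs those in different classes; by Delandtsheer--Doyen there are positive integers $m,n$ with $c=(\binom{k}{2}-n)/m$, $d=(\binom{k}{2}-m)/n$, where $n$ is the number of inner pairs in a block and $mc$ the number of outer pairs in a block (the Delandtsheer--Doyen parameters). $\mathrm{Rank}(X)$ is the number of $X$-orbits on $\Omega\times\Omega$ and $\mathrm{PairRank}(X)$ the number of $X$-orbits on unordered pairs of distinct points. *)

(* Defs.v *)
From mathcomp Require Import all_boot all_order all_algebra all_fingroup all_solvable.

Set Implicit Arguments.
Unset Strict Implicit.
Unset Printing Implicit Defensive.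

Import GRing.Theory.

Local Open Scope group_scope.

Section Ranks.

Variable T : finType.

Definition pair_aperm (u : T * T) (g : {perm T}) : T * T := (g u.1, g u.2).

Lemma pair_aperm_is_action : is_action [set: {perm T}] pair_aperm.
Proof.
split=> [g [x y] [x' y'] [/perm_inj-> /perm_inj->] //|[x y] g h _ _].
by rewrite /pair_aperm !permM.
Qed.

Definition pair_action : {action {perm T} &-> T * T} :=
  Action pair_aperm_is_action.

Definition perm_rank (X : {set {perm T}}) : nat :=
  #|orbit pair_action X @: [set: T * T]|.

(* Unordered pairs of distinct points are the 2-subsets of T. *)
Definition pair_rank (X : {set {perm T}}) : nat :=
  #|orbit 'P^* X @: [set e : {set T} | #|e| == 2]|.

End Ranks.

Section Designs.

Variable T : finType.

Record is_2design (Bs : {set {set T}}) (v k lambda : nat) : Prop := Is2Design {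
  design_points : #|[set: T]| = v;
  design_block_size : forall B : {set T}, B \in Bs -> #|B| = k;
  design_pairs : forall x y : T, x != y ->
    #|[set B in Bs | (x \in B) && (y \in B)]| = lambda
}.

Definition design_automorphisms (Bs : {set {set T}}) : {set {perm T}} :=
  'N(Bs | 'P^*).

Definition block_transitive (G : {set {perm T}}) (Bs : {set {set T}}) : bool :=
  [transitive G, on Bs | 'P^*].

Definition point_imprimitive (G : {set {perm T}}) : bool :=
  [transitive G, on [set: T] | 'P] && ~~ [primitive G, on [set: T] | 'P].

Definition leaves_invariant (G : {set {perm T}}) (Cs : {set {set T}}) : bool :=
  partition Cs [set: T] && [acts G, on Cs | 'P^*].

Definition inner_pairs (Cs : {set {set T}}) (B : {set T}) : {set {set T}} :=
  [set [set x; y] | x in B, y in B & (x != y) && (pblock Cs x == pblock Cs y)].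

Definition outer_pairs (Cs : {set {set T}}) (B : {set T}) : {set {set T}} :=
  [set [set x; y] | x in B, y in B & pblock Cs x != pblock Cs y].

(* The fractions c = ('C(k, 2) - n) / m and d = ('C(k, 2) - m) / n are stated
   with the denominators and the subtractions cleared, since those of nat
   truncate. *)
Record Delandtsheer_Doyen_parameters (G : {set {perm T}})
    (Bs Cs : {set {set T}}) (c d k m n : nat) : Prop := DelandtsheerDoyen {
  DD_block_transitive : block_transitive G Bs;
  DD_invariant : leaves_invariant G Cs;
  DD_class_number : #|Cs| = d;
  DD_class_size : forall C : {set T}, C \in Cs -> #|C| = c;
  DD_m_gt0 : 0 < m;
  DD_n_gt0 : 0 < n;
  DD_c : (c * m + n)%N = 'C(k, 2);
  DD_d : (d * n + m)%N = 'C(k, 2);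
  DD_inner : forall B : {set T}, B \in Bs -> #|inner_pairs Cs B| = n;
  DD_outer : forall B : {set T}, B \in Bs -> #|outer_pairs Cs B| = (m * c)%N
}.

End Designs.

Section Wreath.

Variables (T I : finType).

Definition wreath_fun (h : {ffun I -> {perm T}}) (s : {perm I})
  (u : T * I) : T * I := (h u.2 u.1, s u.2).

Lemma wreath_fun_inj h s : injective (wreath_fun h s).
Proof.
by move=> [x i] [y j] [/= exy /perm_inj eij]; move: exy; rewrite eij => /perm_inj->.
Qed.

Definition wreath_perm h s : {perm T * I} := perm (@wreath_fun_inj h s).

Lemma wreath_permE h s x i : wreath_perm h s (x, i) = (h i x, s i).
Proof. by rewrite permE. Qed.

(* The imprimitive action of the wreath product is faithful when T is nonempty;
   the wreath product is represented by its image in the symmetric group. *)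
Definition wreath (H : {set {perm T}}) (K : {set {perm I}}) : {set {perm T * I}} :=
  [set wreath_perm h s | h in ffun_on H, s in K].

Lemma wreath_group_set (H : {group {perm T}}) (K : {group {perm I}}) :
  group_set (wreath H K).
Proof.
apply/group_setP; split.
  apply/imset2P; exists [ffun=> 1] 1; rewrite ?group1 //.
    by apply/ffun_onP=> i; rewrite ffunE group1.
  by apply/permP=> -[x i]; rewrite wreath_permE ffunE !perm1.
move=> _ _ /imset2P[h s /ffun_onP Hh Ks ->] /imset2P[h' s' /ffun_onP Hh' Ks' ->].
apply/imset2P; exists [ffun i => h i * h' (s i)] (s * s'); rewrite ?groupM //.
  by apply/ffun_onP=> i; rewrite ffunE groupM.
by apply/permP=> -[x i]; rewrite permM !wreath_permE ffunE !permM.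
Qed.

Canonical wreath_group H K := group (wreath_group_set H K).

End Wreath.

Section AffineLine.

Variable F : finFieldType.

Lemma affine_inj (u : {unit F}) (b : F) :
  injective (fun x : F => (x * val u + b)%R).
Proof. by move=> x y /addIr /(mulIr (valP u)). Qed.

Definition affine_perm u b : {perm F} := perm (@affine_inj u b).

Lemma affine_permE u b x : affine_perm u b x = (x * val u + b)%R.
Proof. by rewrite permE. Qed.

Definition AGL1 : {set {perm F}} :=
  [set affine_perm u b | u in [set: {unit F}], b in [set: F]].

Definition translations : {set {perm F}} :=
  [set affine_perm 1 b | b in [set: F]].

Definition scaling (u : {unit F}) : {perm F} := affine_perm u 0%R.

(* The semidirect product of the translations by <x |-> x u>; see
   transl_scaling_group_sdprod. *)
Definition transl_scaling_group (u : {unit F}) : {group {perm F}} :=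
  (translations <*> <[scaling u]>)%G.

Lemma affine_permM u b v e : affine_perm u b * affine_perm v e
  = affine_perm (u * v) (b * val v + e)%R.
Proof.
by apply/permP=> x; rewrite permM !affine_permE mulrDl mulrA addrA.
Qed.

Lemma affine_perm1 : affine_perm 1 0%R = 1.
Proof. by apply/permP=> x; rewrite affine_permE perm1 mulr1 addr0. Qed.

Lemma translations_group_set : group_set translations.
Proof.
apply/group_setP; split.
  by apply/imsetP; exists 0%R; rewrite ?inE ?affine_perm1.
move=> _ _ /imsetP[b _ ->] /imsetP[e _ ->]; apply/imsetP; exists (b + e)%R => //.
by rewrite affine_permM mulg1 mulr1.
Qed.

Canonical translations_group := group translations_group_set.

Lemma AGL1_group_set : group_set AGL1.
Proof.
apply/group_setP; split.
  by apply/imset2P; exists 1 0%R; rewrite ?inE ?affine_perm1.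
move=> _ _ /imset2P[u b _ _ ->] /imset2P[v e _ _ ->].
by rewrite affine_permM imset2_f ?inE.
Qed.

Canonical AGL1_group := group AGL1_group_set.

Lemma transl_scaling_group_sdprod u :
  translations ><| <[scaling u]> = transl_scaling_group u.
Proof.
have scalX i : scaling u ^+ i = scaling (u ^+ i).
  elim: i => [|i IHi]; first by rewrite !expg0 /scaling affine_perm1.
  by rewrite !expgSr IHi /scaling affine_permM mul0r addr0.
apply: sdprodEY.
  rewrite cycle_subG inE; apply/subsetP=> _ /imsetP[_ /imsetP[b _ ->] ->].
  apply/imsetP; exists (b * val u)%R => //.
  apply: (mulgI (scaling u)); rewrite /conjg mulKVg.
  by rewrite /scaling !affine_permM mul1g mulg1 addr0 mul0r add0r.
apply/trivgP/subsetP=> _ /setIP[/imsetP[b _ ->] /cycleP[i]].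
rewrite scalX => /permP/(_ 0%R); rewrite !affine_permE !mul0r !add0r => ->.
by rewrite affine_perm1 inE.
Qed.

Lemma transl_scaling_group_sub_AGL1 u : transl_scaling_group u \subset AGL1.
Proof.
rewrite join_subG cycle_subG imset2_f ?inE // andbT.
by apply/subsetP=> _ /imsetP[b _ ->]; rewrite imset2_f ?inE.
Qed.

End AffineLine.

Section BaseBlock.

Variables (F : finFieldType) (d : nat).

Definition class_of (j : 'I_d) : {set F * 'I_d} := [set (x, j) | x in [set: F]].

Definition classes_of : {set {set F * 'I_d}} := [set class_of j | j in [set: 'I_d]].

Definition base_block (zeta : F) (n k : nat) : {set F * 'I_d} :=
  [set (0%R, i) | i : 'I_d & i < n]
    :|: [set ((zeta ^+ i)%R, i) | i : 'I_d & i < n]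
    :|: [set (0%R, i) | i : 'I_d & n <= i < k - n].

End BaseBlock.

Arguments classes_of F d : clear implicits.

(* Main.v *)
Require Import Defs.
From mathcomp Require Import all_boot all_order all_algebra all_fingroup all_solvable.
From mathcomp Require Import zify.

Set Implicit Arguments.
Unset Strict Implicit.
Unset Printing Implicit Defensive.

(** Put q = d - 1 = (c - 1) / n, which is even since c = 1 mod 2n.  For x, y in F
    the value (x - y)^q is a complete invariant of the H-orbit of (x, y), and it
    is symmetric because q is even; so H has n + 1 orbits on ordered pairs (one
    for 0, n for the n-th roots of unity), each of them self-paired.  Similarly
    the G-orbit of a pair of points is determined by whether it is inner and, if
    so, by the q-th power of the difference of its F-coordinates.  The base block
    contains exactly one unordered pair from each of the n inner orbits and c
    outer pairs, in proportion to the sizes of these orbits, and double counting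
    incidences between an orbit of pairs and the orbit of B gives the design. *)

(** * Images of two maps with the same kernel *)

Section ImageCardinal.

Variables (aT rT sT : finType) (A : {set aT}).

(** Each image is in bijection with the set of fibres in [A], and the two sets of fibres agree.
    Orbits get counted this way, through the values of a complete invariant. *)
Lemma eq_card_imset_ker (f : aT -> rT) (g : aT -> sT) :
    {in A &, forall x y, (f x == f y) = (g x == g y)} ->
  #|f @: A| = #|g @: A|.
Proof.
have cardE (uT : finType) (h : aT -> uT) :
    #|h @: A| = #|[set [set y in A | h x == h y] | x in A]|.
  have kerI : {in h @: A &, injective (fun z => [set y in A | z == h y])}.
    move=> _ _ /imsetP[x Ax ->] /imsetP[y Ay ->] /setP/(_ y).
    by rewrite !inE Ay eqxx => /eqP.
  by rewrite -(card_in_imset kerI) -imset_comp.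
move=> fg; rewrite (cardE _ f) (cardE _ g); congr #|pred_of_set _|.
apply: eq_in_imset => x Ax; by apply/setP=> y; rewrite !inE; case Ay: (y \in A); rewrite // fg.
Qed.

End ImageCardinal.

Lemma set2_inj (T : finType) (a b x y : T) :
  [set a; b] = [set x; y] -> a = x /\ b = y \/ a = y /\ b = x.
Proof.
move=> /setP e; move: (e a) (e b) (e x) (e y); rewrite !inE !eqxx ?orbT /=.
case/esym/orP=> /eqP-> /esym/orP[]/eqP->; rewrite ?eqxx; auto.
  by move=> _; rewrite orbb => /eqP->; auto.
by rewrite orbb => /eqP->; auto.
Qed.

(** * Double counting between two orbits *)

Section OrbitIncidence.

Local Open Scope group_scope.

Variables (gT : finGroupType) (X Y : finType).
Variables (toX : {action gT &-> X}) (toY : {action gT &-> Y}).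
Variables (G : {group gT}) (r : X -> Y -> bool).
Hypothesis rG : {in G, forall g x y, r (toX x g) (toY y g) = r x y}.

(** Both sides count the incident pairs in the product of the two orbits: as [r] is invariant, the
    number of partners is constant along each orbit. *)
Lemma orbit_incidence_card x y :
  (#|orbit toX G x| * #|[set y' in orbit toY G y | r x y']|
   = #|orbit toY G y| * #|[set x' in orbit toX G x | r x' y]|)%N.
Proof.
have cardX x' : x' \in orbit toX G x ->
    #|[set y' in orbit toY G y | r x' y']| = #|[set y' in orbit toY G y | r x y']|.
  case/orbitP=> g Gg <-; rewrite -[RHS](card_imset _ (act_inj toY g)); apply: eq_card.
  move=> z; rewrite -(actKV toY g z) (mem_imset _ _ (act_inj toY g)) !inE.
  by rewrite rG // orbit_actr.
have cardY y' : y' \in orbit toY G y ->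
    #|[set x' in orbit toX G x | r x' y']| = #|[set x' in orbit toX G x | r x' y]|.
  case/orbitP=> g Gg <-; rewrite -[RHS](card_imset _ (act_inj toX g)); apply: eq_card.
  move=> z; rewrite -(actKV toX g z) (mem_imset _ _ (act_inj toX g)) !inE.
  by rewrite rG // orbit_actr.
rewrite -!sum_nat_const -(eq_bigr _ cardX) -(eq_bigr _ cardY).
under eq_bigr do rewrite -sum1dep_card; under [RHS]eq_bigr do rewrite -sum1dep_card.
under eq_bigr do rewrite big_mkcondr.
under [RHS]eq_bigr do rewrite big_mkcondr.
exact: exchange_big.
Qed.

End OrbitIncidence.

Lemma orbit_eqE (gT : finGroupType) (X : finType) (to : {action gT &-> X})
    (G : {group gT}) x y :
  (orbit to G x == orbit to G y) = (x \in orbit to G y).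
Proof. by apply/eqP/idP=> /orbit_eqP. Qed.

(** * Orbits on ordered pairs and on 2-subsets *)

Section PairOrbits.

Local Open Scope group_scope.

Variable T : finType.
Implicit Types (X : {group {perm T}}) (w : T * T) (S : {set T}).

Lemma setact_permE S (g : {perm T}) : ('P^*%act S g) = g @: S.
Proof. by []. Qed.

Lemma pair_actionE w (g : {perm T}) : pair_action T w g = (g w.1, g w.2).
Proof. by []. Qed.

(** Reduces the number of blocks through a pair to a count inside the single block [S]. *)
Lemma pair_block_card X S w :
  (#|orbit (pair_action T) X w|
     * #|[set S' in orbit 'P^* X S | (w.1 \in S') && (w.2 \in S')]|
   = #|orbit 'P^* X S|
     * #|[set u in orbit (pair_action T) X w | (u.1 \in S) && (u.2 \in S)]|)%N.
Proof.
apply: (orbit_incidence_card (r := fun (u : T * T) S => (u.1 \in S) && (u.2 \in S))).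
by move=> g _ u S'; rewrite setact_permE /= !mem_imset //; apply: perm_inj.
Qed.

(** The swaps make every orbit of ordered pairs self-paired, so off the diagonal it corresponds to
    one orbit of 2-subsets. By transitivity the diagonal is the one extra orbit. *)
Lemma perm_rank_symmetric X (x0 : T) :
    [transitive X, on [set: T] | 'P] ->
    (forall x y : T, exists2 g, g \in X & g x = y /\ g y = x) ->
  perm_rank X = (pair_rank X + 1)%N.
Proof.
move=> trX swapX.
pose off := [set w : T * T | w.1 != w.2].
pose orb : T * T -> {set T * T} := orbit (pair_action T) X.
have orbE w w' : (orb w == orb w') =
    (orbit 'P^* X [set w.1; w.2] == orbit 'P^* X [set w'.1; w'.2]).
  apply/eqP/eqP=> [/orbit_eqP/orbitP[g Xg <-] | /orbit_eqP/orbitP[g Xg]].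
    apply/esym/orbit_eqP/orbitP; exists g^-1; rewrite ?groupV //= setact_permE.
    by rewrite imsetU !imset_set1 !permK.
  rewrite setact_permE imsetU !imset_set1 => e.
  suff: w \in orb w' by move/orbit_eqP.
  (* If [g] matches the two 2-subsets crosswise, following it by an [h] that swaps the coordinates
     of [w] restores the order. *)
  have [h Xh [h1 h2]] := swapX w.1 w.2.
  case: w w' h1 h2 e => [x y] [x' y'] /= h1 h2 /set2_inj[[<- <-] | [e1 e2]].
    exact: (mem_orbit (pair_action T) (x', y') Xg).
  suff ->: (x, y) = pair_action T (x', y') (g * h) by rewrite mem_orbit ?groupM.
  by rewrite pair_actionE /= !permM e1 e2 h1 h2.
have pairsE : [set e : {set T} | #|e| == 2] = [set [set w.1; w.2] | w in off].
  apply/setP=> e; rewrite inE; apply/cards2P/imsetP=> [[x [y [xy ->]]] | [[x y]]].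
    by exists (x, y); rewrite ?inE.
  by rewrite inE => xy ->; exists x, y.
have -> : pair_rank X = #|orb @: off|.
  rewrite /pair_rank pairsE -imset_comp; apply: eq_card_imset_ker => w w' _ _ /=.
  by rewrite orbE.
have diag x : orb (x, x) = orb (x0, x0).
  have [g Xg ->] := atransP2 trX (in_setT x0) (in_setT x).
  apply/orbit_eqP/orbitP; exists g => //.
have -> : perm_rank X = #|orb (x0, x0) |: orb @: off|.
  congr #|pred_of_set _|; apply/setP=> O; apply/imsetP/setU1P.
    case=> -[x y] _ ->; have [<- | xy] := eqVneq x y; first by left.
    by right; apply/imsetP; exists (x, y); rewrite ?inE.
  by case=> [-> | /imsetP[w _ ->]]; [exists (x0, x0) | exists w].
rewrite cardsU1 addnC; congr (_ + _)%N.
case: imsetP => // -[[x y]]; rewrite inE /= => xy /orbit_eqP/orbitP[g _].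
by rewrite pair_actionE => -[/= e e']; case/eqP: xy; apply: (@perm_inj _ g); rewrite e.
Qed.

End PairOrbits.

(** * Counting inner and outer pairs *)

Section UnorderedPairs.

Variable T : finType.

(** Forgetting the order is two-to-one on [D], with fibres [{(x, y), (y, x)}]. *)
Lemma card_ordered_pairs (D : {set T * T}) :
    {in D, forall w, w.1 != w.2} -> {in D, forall w, (w.2, w.1) \in D} ->
  #|D| = 2 * #|[set [set w.1; w.2] | w in D]|.
Proof.
move=> irrD symD; rewrite -sum1_card (partition_big_imset (fun w => [set w.1; w.2])).
rewrite mulnC -sum_nat_const; apply: eq_bigr => _ /imsetP[[x y] Dxy ->] /=.
(* The 2 is recast as [((x, y) != (y, x)).+1], the form in which [cards2] counts the fibre. *)
rewrite sum1dep_card -[RHS]/(true.+1) -[true](_ : (x, y) != (y, x) = true).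
  rewrite -cards2; apply: eq_card => -[x' y']; rewrite !inE /= !xpair_eqE.
  apply/andP/orP=> [[_ /eqP/set2_inj[[-> ->]|[-> ->]]] | ].
  - by left; rewrite !eqxx.
  - by right; rewrite !eqxx.
  case=> /andP[/eqP-> /eqP->]; first by rewrite eqxx.
  by split; [exact: symD Dxy | rewrite setUC].
by have /= := irrD _ Dxy; apply: contraNT; rewrite negbK => /eqP[->].
Qed.

Variable Cs : {set {set T}}.
Implicit Type B : {set T}.

Lemma card_inner_outer B :
  #|inner_pairs Cs B| + #|outer_pairs Cs B| = 'C(#|B|, 2).
Proof.
have disj : inner_pairs Cs B :&: outer_pairs Cs B = set0.
  apply/setP=> e; rewrite !inE; apply/andP=> -[].
  case/imset2P=> x y _; rewrite inE => /and3P[_ _ /eqP xy] ->.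
  case/imset2P=> x' y' _; rewrite inE => /andP[_ xy'] /set2_inj.
  by case=> [[ex ey]|[ex ey]]; move: xy'; rewrite -ex -ey xy eqxx.
rewrite -cards_draws -cardsUI disj cards0 addn0.
congr #|pred_of_set _|; apply/setP=> e; rewrite !inE.
apply/orP/andP=> [[]|[eB /cards2P[x [y [xy e2]]]]].
- case/imset2P=> x y Bx; rewrite inE => /andP[By /andP[xy _]] ->.
  by rewrite cards2 xy subUset !sub1set Bx By.
- case/imset2P=> x y Bx; rewrite inE => /andP[By xy] ->.
  rewrite cards2 subUset !sub1set Bx By; split=> //.
  by rewrite (contraNneq _ xy) // => ->.
move: eB; rewrite e2 subUset !sub1set => /andP[Bx By].
have [C|C] := boolP (pblock Cs x == pblock Cs y); [left | right];
  by apply/imset2P; exists x y; rewrite // inE By ?xy.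
Qed.

Lemma card_inner_pairs_perm (g : {perm T}) B :
    (forall x y, (pblock Cs (g x) == pblock Cs (g y)) = (pblock Cs x == pblock Cs y)) ->
  #|inner_pairs Cs (g @: B)| = #|inner_pairs Cs B|.
Proof.
move=> gC; suff ->: inner_pairs Cs (g @: B) =
    [set g @: (e : {set T}) | e in inner_pairs Cs B].
  exact/card_imset/imset_inj/perm_inj.
apply/setP=> e; apply/imset2P/imsetP.
  case=> _ z /imsetP[x Bx ->]; rewrite inE => /andP[/imsetP[y By ->]].
  rewrite (inj_eq perm_inj) gC => xyC ->; exists [set x; y].
    by apply/imset2P; exists x y; rewrite // inE By.
  by rewrite imsetU !imset_set1.
case=> e0 /imset2P[x y Bx]; rewrite inE => /andP[By xyC] -> ->.
exists (g x) (g y); rewrite ?imset_f ?inE ?(inj_eq perm_inj) ?gC ?imset_f //.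
by rewrite imsetU !imset_set1.
Qed.

End UnorderedPairs.

(** * The symmetric group on pairs of points *)

Section SymmetricGroup.

Local Open Scope group_scope.

Variable T : finType.

Lemma Sym_two_transitive (i j i' j' : T) : (i == j) = (i' == j') ->
  exists2 s : {perm T}, s i = i' & s j = j'.
Proof.
have [<- /esym/eqP<- | ij /esym/negbT ij'] := eqVneq i j.
  by exists (tperm i i'); rewrite tpermL.
(* The first transposition takes [i] to [i']; the second moves the image of [j] to [j'] and fixes
   [i']. *)
exists (tperm i i' * tperm (tperm i i' j) j'); rewrite permM ?tpermL //.
by rewrite tpermD // 1?eq_sym // -{1}(tpermL i i') (inj_eq perm_inj).
Qed.

Lemma Sym_pair_orbit (w w' : T * T) :
  (w' \in orbit (pair_action T) [set: {perm T}] w)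
  = ((w.1 == w.2) == (w'.1 == w'.2)).
Proof.
case: w w' => [i j] [i' j']; apply/orbitP/eqP=> /= [[s _ [<- <-]]|].
  by rewrite (inj_eq perm_inj).
by case/Sym_two_transitive=> s <- <-; exists s; rewrite ?inE.
Qed.

Lemma perm_rank_Sym : 1 < #|T| -> perm_rank [set: {perm T}] = 2.
Proof.
case/card_gt1P=> i [j [_ _ ij]].
rewrite /perm_rank (eq_card_imset_ker (g := fun w : T * T => w.1 == w.2)); last first.
  by move=> w w' _ _; rewrite orbit_eqE orbit_sym Sym_pair_orbit.
rewrite -card_bool -cardsT; congr #|pred_of_set _|; apply/setP=> b; rewrite [RHS]inE.
apply/imsetP; case: b; [exists (i, i) | exists (i, j)]; rewrite ?inE //=.
  by rewrite eqxx.
by rewrite (negPf ij).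
Qed.

Lemma pair_orbit_transitive (X : {group {perm T}}) (x0 : T) :
  (forall x y, (y, y) \in orbit (pair_action T) X (x, x)) ->
  [transitive X, on [set: T] | 'P].
Proof.
move=> diag; apply/imsetP; exists x0; rewrite ?inE //; apply/setP=> y; rewrite inE.
have /orbitP[g Xg [<- _]] := diag x0 y.
exact/esym/(mem_orbit 'P x0 Xg).
Qed.

End SymmetricGroup.

(** * The residues [x ^+ q] and the orbits of [H] on pairs *)

Section PowerResidues.

Import GRing.Theory.
Local Open Scope group_scope.

Variables (F : finFieldType) (zeta : {unit F}) (n q : nat).
Hypotheses (n_gt0 : 0 < n) (q_gt0 : 0 < q) (cardF : #|F| = (q * n).+1).
Hypothesis zetaP : generator [set: {unit F}] zeta.

Notation z := (val zeta).
Notation H := (transl_scaling_group (zeta ^+ n)).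

Lemma order_primitive : #[zeta] = (q * n)%N.
Proof. by rewrite /order -(eqP zetaP) card_finField_unit cardF. Qed.

Lemma order_primitive_pow : #[zeta ^+ n] = q.
Proof. by rewrite orderXdiv order_primitive ?mulnK ?dvdn_mull. Qed.

Lemma primitive_pow (x : F) : x != 0%R -> exists i, x = (z ^+ i)%R.
Proof.
rewrite -unitfE => Ux; have: Sub x Ux \in <[zeta]> by rewrite -(eqP zetaP) inE.
by case/cycleP=> i /(congr1 val) /=; rewrite FinRing.val_unitX => ->; exists i.
Qed.

Lemma pow_eq_primitive i j : ((z ^+ i)%R == (z ^+ j)%R) = (i == j %[mod q * n]).
Proof.
by rewrite -!FinRing.val_unitX (inj_eq val_inj) eq_expg_mod_order order_primitive.
Qed.

(** Exponents of [z] count modulo [q * n], and the common factor [q] cancels. *)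
Lemma residue_eq_primitive i j :
  ((z ^+ i) ^+ q == (z ^+ j) ^+ q)%R = (i == j %[mod n]).
Proof.
by rewrite -!exprM pow_eq_primitive ![(_ * q)%N]mulnC -!muln_modr eqn_pmul2l.
Qed.

(** The kernel of the [q]-th power map on units is the subgroup of order [q] of a cyclic group. *)
Lemma residue_unit (u : {unit F}) : (val u ^+ q == 1)%R = (u \in <[zeta ^+ n]>).
Proof.
have: u \in <[zeta]> by rewrite -(eqP zetaP) inE.
case/cycleP=> i ->; rewrite FinRing.val_unitX -(expr1n _ q) -(expr0 z).
rewrite residue_eq_primitive mod0n; apply/eqP/cycleP=> [/eqP/dvdnP[m ->] | [m]].
  by exists m; rewrite mulnC expgM.
rewrite -expgM => /eqP; rewrite eq_expg_mod_order order_primitive.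
move=> /eqP/(congr1 (modn^~ n)); by rewrite !modn_dvdm ?dvdn_mull // modnMr.
Qed.

Lemma residue_eq0 (x : F) : (x ^+ q == 0)%R = (x == 0%R).
Proof. by rewrite expf_eq0 q_gt0. Qed.

Lemma residue_eq (x y : F) : (x ^+ q = y ^+ q)%R ->
  exists2 u : {unit F}, u \in <[zeta ^+ n]> & y = (x * val u)%R.
Proof.
have [-> /esym/eqP | nx xy] := eqVneq x 0%R.
  (* As [q] is positive, only 0 has residue 0, and there [u = 1] serves. *)
  rewrite expr0n gtn_eqF // residue_eq0 => /eqP->.
  by exists 1; rewrite ?group1 ?mul0r.
have ny : (y / x)%R \is a GRing.unit.
  by rewrite unitfE mulf_neq0 ?invr_eq0 // -residue_eq0 -xy residue_eq0.
exists (Sub (y / x)%R ny); last by rewrite SubK mulrC divfK.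
by rewrite -residue_unit SubK exprMn exprVn xy mulfV // -xy expf_neq0.
Qed.

(** The fibre is the coset of [<[zeta ^+ n]>] through [x]. *)
Lemma card_residue_fiber (x : F) : x != 0%R -> #|[set y | (y ^+ q == x ^+ q)%R]| = q.
Proof.
move=> nx; rewrite -[RHS]order_primitive_pow /order.
rewrite -(card_imset (mem <[zeta ^+ n]>) (_ : injective (fun u => x * val u)%R)); last first.
  by move=> u v /(mulfI nx) /val_inj.
congr #|pred_of_set _|; apply/setP=> y; rewrite inE; apply/eqP/imsetP.
  by move/esym/residue_eq.
by case=> u; rewrite -residue_unit => /eqP ux ->; rewrite exprMn ux mulr1.
Qed.

Lemma scalingX (u : {unit F}) m : scaling u ^+ m = scaling (u ^+ m).
Proof.
elim: m => [|m IHm]; first by rewrite !expg0 /scaling affine_perm1.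
by rewrite !expgSr IHm /scaling affine_permM mul0r addr0.
Qed.

Lemma affine_perm_transl_scaling u b :
  u \in <[zeta ^+ n]> -> affine_perm u b \in H.
Proof.
case/cycleP=> m ->.
have -> : affine_perm (zeta ^+ n ^+ m) b = scaling (zeta ^+ n) ^+ m * affine_perm 1 b.
  by rewrite scalingX affine_permM mulg1 mul0r add0r.
have sH : scaling (zeta ^+ n) \in H.
  exact: (subsetP (joing_subr _ _)) (cycle_id _).
have tH : affine_perm 1 b \in H.
  by apply: (subsetP (joing_subl _ _)); apply: imset_f.
exact: groupM (groupX m sH) tH.
Qed.

(** Translations cancel in the difference, and scalings multiply it by a power of [zeta ^+ n], whose
    [q]-th power is 1. *)
Lemma transl_scaling_residue h x y : h \in H ->
  ((h x - h y) ^+ q = (x - y) ^+ q)%R.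
Proof.
rewrite -(sdprodW (transl_scaling_group_sdprod _)).
case/mulsgP=> _ s /imsetP[b _ ->] /cycleP[m ->] ->.
rewrite scalingX !permM !affine_permE !mulr1 !addr0 -mulrBl opprD addrACA subrr addr0.
have /eqP u1: (val (zeta ^+ n ^+ m)%g ^+ q == 1)%R by rewrite residue_unit mem_cycle.
by rewrite exprMn u1 mulr1.
Qed.

Lemma transl_scaling_pair_orbit (w w' : F * F) :
  (w' \in orbit (pair_action F) H w)
  = ((w.1 - w.2) ^+ q == (w'.1 - w'.2) ^+ q)%R.
Proof.
case: w w' => [x y] [x' y']; apply/orbitP/eqP=> /= [[h Hh [<- <-]]|].
  by rewrite transl_scaling_residue.
(* The translation part is chosen to send [x] to [x']; then [e], which relates the differences,
   forces [y] to [y']. *)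
case/residue_eq=> u Hu e; exists (affine_perm u (x' - x * val u)%R).
  exact: affine_perm_transl_scaling.
rewrite /pair_aperm /= !affine_permE addrC subrK; congr (_, _).
by rewrite addrCA -mulrBl -opprB mulNr -e subKr.
Qed.

(** The residues that occur are 0, on the diagonal, and the [n] distinct values [(z ^+ i) ^+ q] with
    [i < n]. *)
Lemma perm_rank_transl_scaling : perm_rank H = n.+1.
Proof.
pose res (w : F * F) := ((w.1 - w.2) ^+ q)%R.
rewrite /perm_rank (eq_card_imset_ker (g := res)); last first.
  by move=> w w' _ _; rewrite orbit_eqE orbit_sym transl_scaling_pair_orbit.
pose nz := [set ((z ^+ val i) ^+ q)%R | i : 'I_n].
have -> : res @: [set: F * F] = 0%R |: nz.
  apply/setP=> y; apply/imsetP/setU1P=> [[[x x'] _ ->] | [-> | /imsetP[i _ ->]]].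
  - rewrite /res /=; have [-> | /primitive_pow[i ->]] := eqVneq (x - x')%R 0%R.
      by left; rewrite expr0n gtn_eqF.
    right; apply/imsetP; exists (Ordinal (ltn_pmod i n_gt0)) => //.
    by apply/eqP; rewrite residue_eq_primitive /= modn_mod.
  - by exists (0%R, 0%R); rewrite // /res subrr expr0n gtn_eqF.
  by exists ((z ^+ val i)%R, 0%R); rewrite // /res subr0.
rewrite cardsU1 card_imset; last first.
  by move=> i j /eqP; rewrite residue_eq_primitive !modn_small ?ltn_ord // => /eqP/val_inj.
rewrite card_ord; case: imsetP => // -[i _ /esym/eqP].
by rewrite residue_eq0 expf_eq0 -[_ == _]negbK -unitfE (valP zeta) andbF.
Qed.

Hypothesis even_q : ~~ odd q.

Lemma residueN (x : F) : ((- x) ^+ q = x ^+ q)%R.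
Proof. by rewrite exprNn -signr_odd (negPf even_q) mul1r. Qed.

End PowerResidues.

(** * The wreath product [G] and its orbits on pairs *)

Section WreathDesign.

Import GRing.Theory.
Local Open Scope group_scope.

Variables (F : finFieldType) (zeta : {unit F}) (n q d k : nat).
Hypotheses (n_gt0 : 0 < n) (q_gt0 : 0 < q) (even_q : ~~ odd q).
Hypotheses (cardF : #|F| = (q * n).+1) (dE : d = q.+1).
Hypothesis zetaP : generator [set: {unit F}] zeta.
Hypotheses (nk : 2 * n <= k) (kE : 'C(k, 2) = ((q * n).+1 + n)%N).

Notation z := (val zeta).
Notation H := (transl_scaling_group (zeta ^+ n)).
Notation G := (wreath_group H [set: {perm 'I_d}]).
Notation Cs := (classes_of F d).
Notation B := (base_block d z n k).
Notation point := (F * 'I_d)%type.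

(** [None] marks the outer pairs; [Some 0] is the diagonal, and the other values are the residues of
    inner pairs. *)
Let pair_class (w : point * point) : option F :=
  if w.1.2 == w.2.2 then Some ((w.1.1 - w.2.1) ^+ q)%R else None.

Lemma wreath_pair_orbit w w' :
  (w' \in orbit (pair_action point) G w) = (pair_class w == pair_class w').
Proof.
case: w w' => [[x i] [y j]] [[x' i'] [y' j']]; rewrite /pair_class /=.
apply/orbitP/idP => [[g]|].
  case/imset2P=> h s /ffun_onP Hh _ ->; rewrite /= /pair_aperm /= !wreath_permE.
  case=> <- <- <- <-; rewrite (inj_eq perm_inj); case: (eqVneq i j) => [<-|_]; rewrite ?eqxx //.
  by rewrite (transl_scaling_residue q_gt0 cardF zetaP).
have [eij | nij] := eqVneq i j; last first.
  have [// | nij' _] := eqVneq i' j'.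
  have [s si sj] : exists2 s : {perm 'I_d}, s i = i' & s j = j'.
    by apply: Sym_two_transitive; rewrite (negPf nij) (negPf nij').
  (* Distinct classes carry independent components of the base group, so [x] and [y] can be
     translated separately. *)
  pose h := [ffun l => affine_perm 1 (if l == i then x' - x else y' - y)%R].
  exists (wreath_perm h s).
    apply/imset2P; exists h s; rewrite ?inE //; apply/ffun_onP=> l; rewrite ffunE.
    exact/affine_perm_transl_scaling/group1.
  rewrite /= /pair_aperm /= !wreath_permE !ffunE eqxx eq_sym (negPf nij) si sj.
  by rewrite !affine_permE !mulr1 !(addrC x) !(addrC y) !subrK.
have [eij' | //] := eqVneq i' j'; rewrite -eij -eij' => /eqP[e].
have /orbitP[h Hh []] : (x', y') \in orbit (pair_action F) H (x, y).
  by rewrite (transl_scaling_pair_orbit q_gt0 cardF zetaP) e.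
(* Within one class a single [h] must move both coordinates; the transposition then carries class
   [i] to class [i']. *)
move=> hx hy; exists (wreath_perm [ffun=> h] (tperm i i')).
  apply/imset2P; exists [ffun=> h] (tperm i i'); rewrite ?inE //.
  by apply/ffun_onP=> l; rewrite ffunE.
by rewrite /= /pair_aperm /= !wreath_permE !ffunE tpermL hx hy.
Qed.

Lemma wreath_transitive : [transitive G, on [set: point] | 'P].
Proof.
have d_gt0 : 0 < d by rewrite dE.
apply: (pair_orbit_transitive (0%R, Ordinal d_gt0)) => u v.
by rewrite wreath_pair_orbit /pair_class !eqxx !subrr.
Qed.

Lemma wreath_same_class (g : {perm point}) : g \in G ->
  forall u v : point, ((g u).2 == (g v).2) = (u.2 == v.2).
Proof.
case/imset2P=> h s _ _ -> [x i] [y j].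
by rewrite !wreath_permE (inj_eq perm_inj).
Qed.

(** * The classes as a system of imprimitivity *)

Lemma mem_class_of (u : point) j : (u \in class_of F j) = (u.2 == j).
Proof.
case: u => x i; apply/imsetP/eqP=> /= [[y _ [_ ->]] // | ->].
by exists x.
Qed.

Lemma classes_of_partition : partition Cs [set: point].
Proof.
apply/and3P; split.
- apply/eqP/setP=> u; rewrite inE; apply/bigcupP; exists (class_of F u.2).
    exact: imset_f.
  by rewrite mem_class_of.
- apply/trivIsetP=> _ _ /imsetP[i _ ->] /imsetP[j _ ->] nij.
  rewrite -setI_eq0; apply/eqP/setP=> u; rewrite !inE !mem_class_of.
  by apply: contraNF nij => /andP[/eqP<- /eqP<-].
apply/imsetP=> -[j _ /setP/(_ (0%R, j))].
by rewrite inE mem_class_of eqxx.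
Qed.

Lemma pblock_classes_of (u v : point) :
  (pblock Cs u == pblock Cs v) = (u.2 == v.2).
Proof.
have /and3P[_ tiC _] := classes_of_partition.
have pE (w : point) : pblock Cs w = class_of F w.2.
  by apply: def_pblock; rewrite ?imset_f ?mem_class_of.
apply/eqP/eqP=> [|e]; rewrite !pE ?e // => /setP/(_ u).
by rewrite !mem_class_of eqxx => /esym/eqP.
Qed.

Lemma class_of_inj : injective (@class_of F d).
Proof.
by move=> i j /setP/(_ (0%R, i)); rewrite !mem_class_of /= eqxx => /esym/eqP.
Qed.

Lemma card_classes_of : #|Cs| = d.
Proof. by rewrite card_imset ?cardsT ?card_ord //; apply: class_of_inj. Qed.

Lemma card_class_of j : #|class_of F (j : 'I_d)| = #|F|.
Proof. by rewrite card_imset ?cardsT // => x y []. Qed.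

Lemma wreath_leaves_classes_invariant : leaves_invariant G Cs.
Proof.
rewrite /leaves_invariant classes_of_partition /=.
have sub g S : g \in G -> S \in Cs -> g @: S \in Cs.
  case/imset2P=> h s _ _ -> /imsetP[j _ ->].
  suff -> : wreath_perm h s @: class_of F j = class_of F (s j) by rewrite imset_f.
  apply/eqP; rewrite eqEcard (card_imset _ perm_inj) !card_class_of leqnn andbT.
  apply/subsetP=> _ /imsetP[[x i] + ->]; rewrite !mem_class_of wreath_permE /=.
  by move/eqP->.
apply/actsP=> g Gg S; apply/idP/idP=> [|SC]; last exact: sub.
by move/(sub _ _ (groupVr Gg)); rewrite -setact_permE actK.
Qed.

Lemma wreath_imprimitive : point_imprimitive G.
Proof.
rewrite /point_imprimitive wreath_transitive negb_and wreath_transitive /= negbK.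
apply/existsP; exists Cs; rewrite /imprimitivity_system.
have /andP[-> ->] := wreath_leaves_classes_invariant.
(* What remains is that the system is nontrivial: [1 < d < c * d], where [d = q + 1] and
   [c = q * n + 1]. *)
rewrite card_classes_of cardsT card_prod card_ord cardF /=.
by rewrite dE; clear -n_gt0 q_gt0; nia.
Qed.

(** * The base block and its pairs *)

Lemma mem_base_block (u : point) :
  (u \in B) = [|| (u.1 == 0%R) && (u.2 < k - n) | (u.1 == (z ^+ u.2)%R) && (u.2 < n)].
Proof.
(* This merges the zero points of the first and third pieces of [B] into those of index below
   [k - n]. *)
have nkn : n <= k - n by lia.
case: u => x i; rewrite !inE /=; apply/idP/idP.
  case/orP=> [/orP[]|] /imsetP[j]; rewrite inE => jn [-> ->]; rewrite eqxx.
  - by rewrite (leq_trans jn nkn).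
  - by rewrite jn orbT.
  by case/andP: jn => _ ->.
case/orP=> /andP[/eqP-> ik].
  have [lin | lni] := ltnP i n; apply/orP; [left | right].
    by apply/orP; left; apply/imsetP; exists i; rewrite ?inE.
  by apply/imsetP; exists i; rewrite ?inE ?lni.
by apply/orP; left; apply/orP; right; apply/imsetP; exists i; rewrite ?inE.
Qed.

(** Ensures that there are enough classes for [B] to have all its [k] points. Here
    [k (k - 1) = 2 (n d + 1)]; if [s = k - n] exceeded [d], then [s (s - 1) + n (n + 1) <= 2], which
    is impossible as [d >= 2]. *)
Lemma base_block_fits : k - n <= d.
Proof.
have := bin_ffact k 2; rewrite kE dE ffactnS ffactn1 (_ : 2`! = 2) //; nia.
Qed.

Let low m := [set i : 'I_d | i < m].

Let card_low m : m <= d -> #|low m| = m.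
Proof.
by move=> md; rewrite -sum1dep_card -(big_ord_widen d (fun=> 1%N) md) sum1_card card_ord.
Qed.

Let n_le_d : n <= d.
Proof. by apply: leq_trans base_block_fits; lia. Qed.

Let primitive_pow_neq0 i : (z ^+ i != 0)%R.
Proof. by rewrite expf_eq0 -[_ == _]negbK -unitfE (valP zeta) andbF. Qed.

Lemma card_base_block : #|B| = k.
Proof.
have -> : B =
    [set (0%R, i) | i in low (k - n)] :|: [set ((z ^+ val i)%R, i) | i in low n].
  apply/setP=> -[x i]; rewrite mem_base_block inE /=; congr (_ || _).
    apply/andP/imsetP=> [[/eqP-> ik] | [j jk [-> ->]]]; last by rewrite inE in jk.
    by exists i; rewrite ?inE.
  apply/andP/imsetP=> [[/eqP-> ik] | [j jk [-> ->]]]; last by rewrite inE in jk.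
  by exists i; rewrite ?inE.
rewrite cardsU (_ : _ :&: _ = set0); last first.
  apply/setP=> u; rewrite !inE.
  apply/andP=> -[/imsetP[i _ ->] /imsetP[j _ [/esym/eqP]]].
  by rewrite (negPf (primitive_pow_neq0 j)).
rewrite cards0 subn0 !card_imset ?card_low ?base_block_fits //; first by lia.
  by move=> i j [_].
by move=> i j [].
Qed.

(** A class of index [i < n] meets [B] in [(0, i)] and [(z ^+ i, i)], any other class in at most one
    point. *)
Lemma base_block_same_class (u v : point) : u \in B -> v \in B -> u != v -> u.2 = v.2 ->
  (u.2 < n) && (((u.1 == 0) && (v.1 == z ^+ u.2)) || ((v.1 == 0) && (u.1 == z ^+ u.2)))%R.
Proof.
case: u v => [x i] [y j] + + + /= ij; rewrite -ij !mem_base_block /= xpair_eqE eqxx andbT.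
case/orP=> /andP[/eqP-> ik] /orP[]/andP[/eqP-> jk]; rewrite ?eqxx //= ?orbT ?andbT //.
Qed.

Lemma card_inner_pairs_base_block : #|inner_pairs Cs B| = n.
Proof.
rewrite -[RHS](card_low n_le_d).
have injf : injective (fun i : 'I_d => [set (0%R : F, i); ((z ^+ val i)%R, i)]).
  by move=> i j /set2_inj[[[->]] | [[_ ->]]].
rewrite -(card_imset _ injf); congr #|pred_of_set _|.
apply/setP=> e; apply/imset2P/imsetP.
  case=> u v uB; rewrite inE => /and3P[vB uv]; rewrite pblock_classes_of => /eqP uv2 ->.
  have /andP[un uvE] := base_block_same_class uB vB uv uv2.
  exists u.2; first by rewrite inE.
  case: u v uv2 {uv uB vB un} uvE => [x i] [y j] /= <-.
  by case/orP=> /andP[/eqP-> /eqP->] //; rewrite setUC.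
case=> i; rewrite inE => lin ->; exists (0%R, i) ((z ^+ val i)%R, i) => //.
  by rewrite mem_base_block /= eqxx; apply/orP; left; lia.
rewrite inE mem_base_block /= eqxx lin orbT pblock_classes_of eqxx andbT.
by rewrite xpair_eqE eqxx andbT eq_sym primitive_pow_neq0.
Qed.

(** The pairs that are not inner number ['C(k, 2) - n], which is the order of the field by [kE]. *)
Lemma card_outer_pairs_base_block : #|outer_pairs Cs B| = #|F|.
Proof.
have := card_inner_outer Cs B.
by rewrite card_base_block card_inner_pairs_base_block kE cardF; lia.
Qed.

(** * Orbits of pairs: their sizes and their intersections with [B] *)

Lemma card_inner_pair_class (x : F) : x != 0%R ->
  #|[set w | pair_class w == Some (x ^+ q)%R]| = (d * (#|F| * q))%N.
Proof.
move=> nx; pose fiber := [set t : F | (t ^+ q == x ^+ q)%R].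
have -> : (d * (#|F| * q))%N = #|setX [set: 'I_d] (setX [set: F] fiber)|.
  by rewrite !cardsX !cardsT card_ord (card_residue_fiber n_gt0 q_gt0 cardF zetaP nx).
(* An inner pair is given by its class, its second coordinate and the difference of its coordinates,
   with [d], [#|F|] and [q] choices. *)
pose f (u : 'I_d * (F * F)) : point * point := ((u.2.1 + u.2.2, u.1), (u.2.1, u.1))%R.
have injf : injective f.
  by case=> [i [a b]] [j [a' b']] [e -> ea]; move: e; rewrite ea => /addrI->.
rewrite -(card_imset _ injf); congr #|pred_of_set _|.
apply/setP=> -[[a i] [b j]]; rewrite inE /pair_class /=; apply/idP/imsetP.
  case: (eqVneq i j) => // <- /eqP[abx]; exists (i, (b, (a - b)%R)).
    by rewrite !inE /= abx.
  by rewrite /f /= addrC subrK.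
case=> -[l [y t]]; rewrite !inE /= => /eqP tx [-> -> -> ->]; rewrite eqxx.
by rewrite addrC addKr tx.
Qed.

(** By complement, [(c d)^2 - c^2 d = c^2 d (d - 1)] with [d - 1 = q], arranged as [c] times the
    size of an inner orbit. *)
Lemma card_outer_pair_class :
  #|[set w | pair_class w == None]| = (#|F| * (d * (#|F| * q)))%N.
Proof.
pose same := [set w : point * point | w.1.2 == w.2.2].
have -> : [set w | pair_class w == None] = ~: same.
  by apply/setP=> w; rewrite !inE /pair_class; case: (w.1.2 == w.2.2).
have same_card : #|same| = (#|F| * #|F| * d)%N.
  have -> : (#|F| * #|F| * d)%N = #|[set: (F * F) * 'I_d]|.
    by rewrite cardsT !card_prod card_ord.
  pose f (u : (F * F) * 'I_d) : point * point := ((u.1.1, u.2), (u.1.2, u.2)).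
  have injf : injective f by case=> [[a b] i] [[a' b'] j] [-> -> ->].
  rewrite -(card_imset _ injf); congr #|pred_of_set _|.
  apply/setP=> -[[a i] [b j]]; rewrite inE /=; apply/eqP/imsetP.
    2: by case=> ? _ [_ -> _ ->].
  move=> <-.
  by exists ((a, b), i); rewrite ?inE.
rewrite cardsCs setCK same_card !card_prod card_ord dE.
set c := #|F|; suff -> : (c * q.+1 * (c * q.+1) = c * (q.+1 * (c * q)) + c * c * q.+1)%N.
  by rewrite addnK.
by lia.
Qed.

(** Exactly one [i < n] gives [z ^+ i] the residue of [x]. This leaves the pair of [(0, i)] and
    [(z ^+ i, i)], whose two orders share a residue because [q] is even. *)
Lemma card_inner_class_base_block (x : F) : x != 0%R ->
  #|[set w | (pair_class w == Some (x ^+ q)%R) && ((w.1 \in B) && (w.2 \in B))]| = 2.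
Proof.
case/(primitive_pow zetaP)=> m ->.
have in_n : m %% n < n by rewrite ltn_pmod.
pose i := Ordinal (leq_trans in_n n_le_d).
pose u : point := (0%R, i); pose v : point := ((z ^+ val i)%R, i).
have uB : u \in B by rewrite mem_base_block /= eqxx; apply/orP; left; lia.
have vB : v \in B by rewrite mem_base_block /= eqxx in_n orbT.
have uv : u != v by rewrite xpair_eqE eqxx andbT eq_sym primitive_pow_neq0.
have mi : ((z ^+ m) ^+ q = (z ^+ val i) ^+ q)%R.
  by apply/eqP; rewrite (residue_eq_primitive q_gt0 cardF zetaP) /= modn_mod.
transitivity #|[set (u, v); (v, u)]|; last by rewrite cards2 xpair_eqE negb_and uv.
congr #|pred_of_set _|; apply/setP=> w; rewrite in_set in_set2.
apply/and3P/orP=> [[+ aB bB] | [/eqP-> | /eqP->]]; last 2 first.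
- by rewrite /pair_class /= eqxx sub0r residueN // mi eqxx uB vB.
- by rewrite /pair_class /= eqxx subr0 mi eqxx uB vB.
case: w aB bB => a b /= aB bB; rewrite /pair_class /=.
case: (eqVneq a.2 b.2) => // ab /eqP[abm].
have nab : a != b.
  apply: contra_eq_neq abm => ->; rewrite subrr expr0n gtn_eqF // eq_sym.
  by rewrite residue_eq0 // primitive_pow_neq0.
have /andP[an] := base_block_same_class aB bB nab ab.
have ai : forall e, (e ^+ q = (z ^+ m) ^+ q)%R -> e = (z ^+ a.2)%R -> a.2 = i.
  move=> e + ee; rewrite ee => /eqP; rewrite (residue_eq_primitive q_gt0 cardF zetaP).
  by rewrite modn_small // => /eqP e'; apply: val_inj.
case: a b ab abm ai {aB bB nab an} => [a j] [b j'] /= <- abm ai.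
case/orP=> /andP[/eqP ea /eqP eb]; rewrite ea eb in abm *.
  left; rewrite (ai _ _ erefl) // -abm sub0r residueN //.
by right; rewrite (ai _ _ erefl) // -abm subr0.
Qed.

Lemma card_outer_class_base_block :
  #|[set w | (pair_class w == None) && ((w.1 \in B) && (w.2 \in B))]| = (2 * #|F|)%N.
Proof.
rewrite card_ordered_pairs.
- rewrite -card_outer_pairs_base_block; congr (2 * #|pred_of_set _|)%N.
  apply/setP=> e; apply/imsetP/imset2P=> [[[u v]] | [u v uB]].
    rewrite inE /pair_class /=; case: (eqVneq u.2 v.2) => // uv /and3P[_ uB vB] ->.
    by exists u v; rewrite // inE vB pblock_classes_of.
  rewrite inE pblock_classes_of => /andP[vB uv] ->.
  by exists (u, v); rewrite // inE /pair_class /= (negPf uv) eqxx uB.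
- move=> [u v]; rewrite inE /pair_class /=; case: (eqVneq u.2 v.2) => // uv _.
  by apply: contraNneq uv => ->.
move=> [u v]; rewrite !inE /pair_class /= [v.2 == _]eq_sym.
by case: (eqVneq u.2 v.2) => // _ /and3P[_ -> ->].
Qed.

(* An orbit of ordered pairs contains either 2 of the pairs of [B] and has
   size [d c q] (inner), or 2c of them and has size [c d c q] (outer): the
   ratio is the same, so every pair lies in the same number of blocks. *)
Lemma wreath_orbit_2design :
  exists lambda, is_2design (orbit 'P^* G B) (#|F| * d) k lambda.
Proof.
pose Bs := orbit 'P^* G B; pose M := (d * (#|F| * q))%N.
have F_gt0 : 0 < #|F| by rewrite cardF.
have M_gt0 : 0 < M by rewrite /M dE !muln_gt0 F_gt0.
(* The division is exact: [M] times the number of blocks through any pair turns out to be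
   [#|Bs| * 2]. *)
exists ((#|Bs| * 2) %/ M)%N; split.
- by rewrite cardsT card_prod card_ord.
- move=> _ /orbitP[g _ <-].
  by rewrite setact_permE (card_imset _ perm_inj) card_base_block.
move=> u v uv; set N := #|_|; suff -> : (#|Bs| * 2)%N = (M * N)%N by rewrite mulKn.
have := pair_block_card G B (u, v); rewrite -/Bs -/N.
have orbE P : [set w in orbit (pair_action point) G (u, v) | P w]
    = [set w | (pair_class w == pair_class (u, v)) && P w].
  by apply/setP=> w; rewrite !inE wreath_pair_orbit eq_sym.
rewrite orbE.
rewrite (_ : #|orbit _ _ _| = #|[set w | pair_class w == pair_class (u, v)]|); last first.
  by congr #|pred_of_set _|; apply/setP=> w; rewrite inE wreath_pair_orbit eq_sym.
rewrite /pair_class /=; have [uv2 | _] := eqVneq u.2 v.2; last first.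
  rewrite card_outer_pair_class card_outer_class_base_block -/M => e.
  apply/eqP; rewrite -(eqn_pmul2l F_gt0) (mulnA _ M) e.
  by rewrite mulnCA (mulnC #|F|).
have nuv : (u.1 - v.1 != 0)%R.
  by rewrite subr_eq0; apply: contraNneq uv => uv1; apply/eqP/injective_projections.
by rewrite card_inner_pair_class // card_inner_class_base_block.
Qed.

Lemma wreath_orbit_inner_pairs S : S \in orbit 'P^* G B -> #|inner_pairs Cs S| = n.
Proof.
case/orbitP=> g Gg <-; rewrite setact_permE -[RHS]card_inner_pairs_base_block.
apply: card_inner_pairs_perm => u v; rewrite !pblock_classes_of.
exact: wreath_same_class Gg u v.
Qed.

Lemma wreath_orbit_outer_pairs S : S \in orbit 'P^* G B -> #|outer_pairs Cs S| = #|F|.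
Proof.
move=> SB; have := card_inner_outer Cs S; rewrite wreath_orbit_inner_pairs //.
case/orbitP: SB => g _ <-; rewrite setact_permE (card_imset _ perm_inj).
by rewrite card_base_block kE cardF; lia.
Qed.

(** As [q] is even, [(x, y)] and [(y, x)] have the same residue, so some element of [H] swaps [x]
    and [y]. *)
Lemma transl_scaling_rank : perm_rank H = (pair_rank H + 1)%N.
Proof.
have orbE := transl_scaling_pair_orbit q_gt0 cardF zetaP.
apply: (perm_rank_symmetric 0%R).
  by apply: pair_orbit_transitive 0%R _ => x y; rewrite orbE /= !subrr.
move=> x y; have /orbitP[h Hh [hx hy]] : (y, x) \in orbit (pair_action F) H (x, y).
  by rewrite orbE /= -opprB residueN.
by exists h.
Qed.

End WreathDesign.

(** * Rank of the symmetric group and final assembly *)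

Lemma Sym_rank (T : finType) : 0 < #|T| ->
  perm_rank [set: {perm T}] = pair_rank [set: {perm T}] + 1.
Proof.
case/card_gt0P=> x0 _; apply: (@perm_rank_symmetric _ [set: {perm T}]%G x0).
  by apply: pair_orbit_transitive x0 _ => x y; rewrite Sym_pair_orbit /= !eqxx.
move=> x y; exists (tperm x y); first by rewrite inE.
by rewrite tpermL tpermR.
Qed.

Theorem theorem5p5 (n p a c k d : nat) (F : finFieldType) (zeta : {unit F})
  (hn : 2 <= n)
  (hp : prime p) (hp_odd : odd p) (ha : 1 <= a) (hc : c = (p ^ a)%N)
  (hc_mod : c = 1 %[mod 2 * n])
  (hk : 2 * n <= k) (hck : c + n = 'C(k, 2))
  (hd : d = 1 + (c - 1) %/ n)
  (hF : #|F| = c)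
  (hzeta : generator [set: {unit F}] zeta) :
  let H : {group {perm F}} := transl_scaling_group (zeta ^+ n)%g in
  let K : {group {perm 'I_d}} := [set: {perm 'I_d}]%G in
  let G : {group {perm F * 'I_d}} := wreath_group H K in
  let Cs : {set {set F * 'I_d}} := classes_of F d in
  let B : {set F * 'I_d} := base_block d (val zeta) n k in
  let Bs : {set {set F * 'I_d}} := orbit 'P^* G B in
  [/\ #|B| = k,
      exists lambda : nat, is_2design Bs (c * d) k lambda,
      [/\ G \subset design_automorphisms Bs,
          block_transitive G Bs,
          point_imprimitive G
        & leaves_invariant G Cs],
      Delandtsheer_Doyen_parameters G Bs Cs c d k 1 n
    & [/\ perm_rank H = pair_rank H + 1,
          pair_rank H + 1 = n + 1,
          perm_rank K = pair_rank K + 1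
        & pair_rank K + 1 = 2]].
Proof.
move=> H K G Cs B Bs.
have n_gt0 : 0 < n by lia.
have c_gt1 : 1 < c.
  by rewrite hc; have := prime_gt1 hp; have := leq_pexp2l (prime_gt0 hp) ha; lia.
have [t ct] : exists t, c = (t * (2 * n)).+1.
  have /eqP := hc_mod; rewrite eqn_mod_dvd ?(ltnW c_gt1) // => /dvdnP[t e].
  by exists t; rewrite -e subn1 prednK // ltnW.
(* This is [(c - 1) / n]; it is even because the congruence holds modulo [2 * n] and not just modulo
   [n]. *)
pose q := 2 * t.
have cq : c = (q * n).+1 by rewrite ct /q; nia.
have q_gt0 : 0 < q by rewrite /q; nia.
have even_q : ~~ odd q by rewrite /q oddM.
have dE : d = q.+1 by rewrite hd cq subn1 /= mulnK.
have cardF : #|F| = (q * n).+1 by rewrite hF.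
have kE : 'C(k, 2) = (q * n).+1 + n by rewrite -hck cq.
have leaves : leaves_invariant G Cs by apply: wreath_leaves_classes_invariant.
have transB : block_transitive G Bs by apply: atrans_orbit.
have rankH := transl_scaling_rank q_gt0 even_q cardF hzeta.
have rankK : perm_rank K = pair_rank K + 1 by apply: Sym_rank; rewrite card_ord dE.
split.
- exact: (card_base_block (q := q)).
- by rewrite -hF; apply: (wreath_orbit_2design (q := q)).
- split=> //; first exact: (acts_orbit _ _ (subsetT _)).
  exact: (wreath_imprimitive (q := q)).
- split=> //.
  + exact: card_classes_of.
  + by move=> _ /imsetP[j _ ->]; rewrite card_class_of.
  + by rewrite muln1.
  + by rewrite kE dE; nia.
  + exact: (wreath_orbit_inner_pairs (q := q)).
  + by rewrite mul1n -hF; apply: (wreath_orbit_outer_pairs (q := q) (zeta := zeta) (n := n)).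
split=> //.
  by rewrite -rankH (perm_rank_transl_scaling n_gt0 q_gt0 cardF hzeta) addn1.
by rewrite -rankK perm_rank_Sym // card_ord dE; lia.
Qed.
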